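(* Let $G$ be a finite group and $S\subset G$. Put $\Gamma=X(G,S)$, $\Gamma^+=X^+(G,S)$, $\Gamma_S=MX(G;S,S)$ and $\Gamma^+_S=MX^+(G;S,S)$. Then $\{\Gamma_S,\Gamma^+_S\}$ are equienergetic and non-isospectral if and only if $\{\Gamma,\Gamma^+\}$ are equienergetic and non-isospectral.
   Context: $X(G,S)$ is the Cayley graph with vertex set $G$ and a directed edge from $h$ to $g$ iff $gh^{-1}\in S$; $X^+(G,S)$ is the Cayley sum graph with vertex set $G$ and a directed edge from $h$ to $g$ iff $gh\in S$ (loops allowed). If $A$ (resp. $A^+$) is the adjacency matrix of $\Gamma$ (resp. $\Gamma^+$), then $\Gamma_S$ (resp. $\Gamma^+_S$) is the graph with vertex set $G\times\mathbb{Z}_2$ and adjacency matrix $\begin{pmatrix}A&A\\ A&A\end{pmatrix}$ (resp. $\begin{pmatrix}A^+&A^+\\ A^+&A^+\end{pmatrix}$). $Spec$ is the multiset of complex eigenvalues of the adjacency matrix counted with (algebraic) multiplicity, and the energy is $\mathcal{E}(\Gamma)=\sum_{\lambda\in Spec(\Gamma)}|\lambda|$. Two graphs with the same number of vertices are equienergetic if they have the same energy and isospectral if they have the same spectrum (as multisets). *)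

(* Defs.v *)
From HB Require Import structures.
From mathcomp Require Import all_boot all_order all_algebra all_fingroup.
From mathcomp Require Import finmap multiset complex reals.

Set Implicit Arguments.
Unset Strict Implicit.
Unset Printing Implicit Defensive.

Import Order.TTheory GRing.Theory Num.Theory.

Local Open Scope ring_scope.

(* A finite directed graph, loops allowed, is a relation [e : rel T] on a
   finite vertex type: [e h g] holds iff there is an edge from [h] to [g]. *)

Definition cayley_graph (gT : finGroupType) (S : {set gT}) : rel gT :=
  fun h g => (g * h^-1)%g \in S.

Definition cayley_sum_graph (gT : finGroupType) (S : {set gT}) : rel gT :=
  fun h g => (g * h)%g \in S.

(* If e has adjacency matrix A, this graph has adjacency matrix
   [[A, A], [A, A]], the blocks being indexed by 'Z_2; see adj_doubling. *)
Definition doubling (T : finType) (e : rel T) : rel (T * 'Z_2) :=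
  fun x y => e x.1 y.1.

Definition mixed_cayley_graph (gT : finGroupType) (S : {set gT}) :
  rel (gT * 'Z_2) := doubling (cayley_graph S).

Definition mixed_cayley_sum_graph (gT : finGroupType) (S : {set gT}) :
  rel (gT * 'Z_2) := doubling (cayley_sum_graph S).

Section Spectra.

Variable C : numClosedFieldType.

Definition adjacency (T : finType) (e : rel T) : 'M[C]_#|T| :=
  \matrix_(i, j) (e (enum_val i) (enum_val j))%:R.

Definition eigenvalues (n : nat) (A : 'M[C]_n) : {mset C}%mset :=
  seq_mset (sval (closed_field_poly_normal (char_poly A))).

Definition spectrum (T : finType) (e : rel T) : {mset C}%mset :=
  eigenvalues (adjacency e).

Definition energy (T : finType) (e : rel T) : C :=
  \sum_(x <- spectrum e) `|x|.

Definition equienergetic (T1 T2 : finType) (e1 : rel T1) (e2 : rel T2) : Prop :=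
  #|T1| = #|T2| /\ energy e1 = energy e2.

Definition isospectral (T1 T2 : finType) (e1 : rel T1) (e2 : rel T2) : Prop :=
  #|T1| = #|T2| /\ spectrum e1 = spectrum e2.

Lemma char_poly_eigenvalues (n : nat) (A : 'M[C]_n) :
  char_poly A = \prod_(x <- eigenvalues A) ('X - x%:P).
Proof.
rewrite /eigenvalues; case: closed_field_poly_normal => r /= Er.
rewrite (perm_big _ (perm_eq_seq_mset r)) {1}Er.
by rewrite (monicP (char_poly_monic A)) scale1r.
Qed.

Lemma eigenvalues_mup (n : nat) (A : 'M[C]_n) (x : C) :
  eigenvalues A x = mup x (char_poly A).
Proof.
rewrite /eigenvalues mset_seqE; case: closed_field_poly_normal => r /= Er.
have {}Er : char_poly A = \prod_(z <- r) ('X - z%:P).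
  by rewrite {1}Er (monicP (char_poly_monic A)) scale1r.
rewrite Er; elim: r {Er} => [|z r IHr]; first by rewrite big_nil mupNroot ?root1.
rewrite big_cons mupM ?polyXsubC_eq0 ?monic_neq0 ?monic_prod_XsubC //.
by rewrite -IHr -['X - _]expr1 mup_XsubCX /=; case: (z == x).
Qed.

Definition layer (T : finType) (k : 'I_(#|T| + #|T|)) : 'I_#|{: T * 'Z_2}| :=
  enum_rank (match split k with
             | inl i => (enum_val i, 0)
             | inr i => (enum_val i, 1)
             end).

Lemma layer_bij (T : finType) : bijective (@layer T).
Proof.
apply: inj_card_bij; last by rewrite !card_ord card_prod card_ord muln2 addnn.
move=> k l /enum_rank_inj E; rewrite -(splitK k) -(splitK l); congr unsplit.
by move: E; case: (split k) => i; case: (split l) => j //= [] /enum_val_inj ->.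
Qed.

Lemma adj_doubling (T : finType) (e : rel T) :
  let A := adjacency e in
  mxsub (@layer T) (@layer T) (adjacency (doubling e)) = block_mx A A A A.
Proof.
apply/matrixP => k l; rewrite !mxE !enum_rankK /doubling.
by case: (split k) => i; rewrite !mxE; case: (split l) => j; rewrite !mxE.
Qed.

End Spectra.

(* Main.v *)
Require Import Defs.
From HB Require Import structures.
From mathcomp Require Import all_boot all_order all_algebra all_fingroup.
From mathcomp Require Import finmap multiset complex reals.
From mathcomp Require Import ring.

(** Conjugating [[A, A], [A, A]] by a unipotent block matrix makes it block
    triangular with diagonal blocks A + A and A - A = 0.  So doubling a graph
    multiplies every eigenvalue by 2 and adds as many zeros as there were
    vertices ([spectrum_doubling]).  This doubles the energy, and the passage
    from the old multiset of eigenvalues to the new one is injective among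
    multisets of a given size.  Hence two graphs are equienergetic exactly when
    their doublings are ([equienergetic_doubling]), and likewise for
    isospectrality ([isospectral_doubling]), so the property of being
    equienergetic and non-isospectral passes both ways. *)

Set Implicit Arguments.
Unset Strict Implicit.
Unset Printing Implicit Defensive.

Import GRing.Theory Num.Theory.

Local Open Scope ring_scope.

Lemma char_poly_mxsub_bij (R : comNzRingType) (m n : nat) (f : 'I_m -> 'I_n)
    (A : 'M[R]_n) :
  bijective f -> char_poly (mxsub f f A) = char_poly A.
Proof.
move=> f_bij.
have eq_mn : m = n by rewrite -[m]card_ord -[n]card_ord; apply: bij_eq_card f_bij.
case: n / eq_mn f A f_bij => f A /bij_inj f_inj.
have -> : mxsub f f A = row_perm (perm f_inj) (col_perm (perm f_inj) A).
  by apply/matrixP => i j; rewrite !mxE !permE.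
rewrite /char_poly; set s := perm f_inj.
have -> : char_poly_mx (row_perm s (col_perm s A)) =
          row_perm s (col_perm s (char_poly_mx A)).
  by apply/matrixP => i j; rewrite !mxE (inj_eq perm_inj).
rewrite row_permE col_permE !det_mulmx !det_perm odd_permV.
(* The two signs of s cancel. *)
by rewrite mulrCA -signr_addb addbb mulr1.
Qed.

(** Subtracting the first block row from the second, then adding the second
    block column to the first, is a conjugation that clears the lower left
    block. *)
Lemma char_poly_block_sym (R : comNzRingType) (n : nat) (A B : 'M[R]_n) :
  char_poly (block_mx A B B A) = char_poly (A + B) * char_poly (A - B).
Proof.
rewrite /char_poly; set M := char_poly_mx (block_mx A B B A).
pose P : 'M[{poly R}]_(n + n) := block_mx 1%:M 0 (- 1%:M) 1%:M.
pose Q : 'M[{poly R}]_(n + n) := block_mx 1%:M 0 1%:M 1%:M.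
have -> : \det M = \det (P *m M *m Q).
  by rewrite !det_mulmx !det_lblock !det1 !mulr1 mul1r.
have -> : P *m M *m Q =
    block_mx (char_poly_mx (A + B)) (- map_mx polyC B)
             0 (char_poly_mx (A - B)).
  rewrite /M /char_poly_mx map_block_mx scalar_mx_block opp_block_mx.
  rewrite add_block_mx !sub0r !mulmx_block.
  rewrite !mul1mx !mul0mx !mulmx1 !mulmx0 !mulNmx !mul1mx !add0r !addr0.
  rewrite map_mxD map_mxB; move: (_%:M) (map_mx _ A) (map_mx _ B) => X A' B'.
  by congr block_mx; apply/matrixP => i j; rewrite !mxE; ring.
by rewrite det_ublock.
Qed.

Lemma char_poly_scale (F : fieldType) (n : nat) (a : F) (A : 'M[F]_n)
    (r : seq F) :
  a != 0 -> char_poly A = \prod_(x <- r) ('X - x%:P) ->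
  char_poly (a *: A) = \prod_(x <- [seq a * x | x <- r]) ('X - x%:P).
Proof.
move=> a0 Er.
have size_r : size r = n.
  by apply: succn_inj; rewrite -(size_char_poly A) Er size_prod_XsubC.
(* Substituting a X for X is invertible, and turns both sides into
   a ^+ n times the characteristic polynomial of A. *)
have substK : cancel (comp_poly (a *: 'X)) (comp_poly (a^-1 *: 'X)).
  move=> p; rewrite -comp_polyA comp_polyZ comp_polyX scalerA divff //.
  by rewrite scale1r comp_polyXr.
apply: (can_inj substK).
have -> : char_poly (a *: A) \Po (a *: 'X) = (a ^+ n)%:P * char_poly A.
  rewrite /char_poly -det_map_mx polyC_exp -detZ.
  congr (\det _); apply/matrixP => i j; rewrite !mxE.
  rewrite /= comp_polyB comp_polyC raddfMn /= comp_polyX mulrBr polyCM.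
  by rewrite -mul_polyC mulrnAr.
rewrite big_map rmorph_prod Er -size_r.
elim: (r) => [|x s IHs] /=; first by rewrite !big_nil mulr1.
rewrite !big_cons -IHs exprS polyCM comp_polyB comp_polyX comp_polyC.
by rewrite -mul_polyC polyCM -mulrBr mulrACA.
Qed.

Lemma eigenvalues_unique (C : numClosedFieldType) (n : nat) (A : 'M[C]_n)
    (r : seq C) :
  char_poly A = \prod_(x <- r) ('X - x%:P) -> eigenvalues A = seq_mset r.
Proof.
rewrite char_poly_eigenvalues => /prod_XsubC_eq /eq_seq_msetP <-.
by rewrite seq_mset_id.
Qed.

(** The eigenvalues 2 x come from the block A + A, the zeros from A - A. *)
Lemma spectrum_doubling (C : numClosedFieldType) (T : finType) (e : rel T) :
  spectrum C (doubling e) =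
  seq_mset ([seq 2 * x | x <- spectrum C e] ++ nseq #|T| 0).
Proof.
apply: eigenvalues_unique.
rewrite -(char_poly_mxsub_bij _ (layer_bij T)) adj_doubling.
rewrite char_poly_block_sym big_cat /=; congr (_ * _).
  rewrite -mulr2n -scaler_nat.
  by apply: char_poly_scale; rewrite ?pnatr_eq0 // char_poly_eigenvalues.
rewrite subrr /char_poly /char_poly_mx map_mx0 subr0 det_scalar.
by rewrite big_nseq subr0 -Monoid.iteropE.
Qed.

Lemma energy_doubling (C : numClosedFieldType) (T : finType) (e : rel T) :
  energy C (doubling e) = 2 * energy C e.
Proof.
rewrite /energy spectrum_doubling (perm_big _ (perm_eq_seq_mset _)) big_cat.
rewrite /= big_map [X in _ + X]big1_seq ?addr0; last first.
  by move=> x /andP[_ /nseqP[-> _]]; rewrite normr0.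
by rewrite mulr_sumr; apply: eq_bigr => x _; rewrite normrM normr_nat.
Qed.

(** When the vertex numbers agree, the zeros appended on the two sides are
    equally many and cancel; halving recovers the original eigenvalues. *)
Lemma spectrum_doubling_inj (C : numClosedFieldType) (T1 T2 : finType)
    (e1 : rel T1) (e2 : rel T2) :
  #|T1| = #|T2| ->
  spectrum C (doubling e1) = spectrum C (doubling e2) <->
  spectrum C e1 = spectrum C e2.
Proof.
move=> eqT; rewrite !spectrum_doubling eqT; split=> [|-> //].
have inj2 : injective ( *%R 2 : C -> C) by apply: mulfI; rewrite pnatr_eq0.
move/eq_seq_msetP; rewrite perm_cat2r => /(perm_map_inj inj2) /eq_seq_msetP.
by rewrite !seq_mset_id.
Qed.

Lemma isospectral_doubling (C : numClosedFieldType) (T1 T2 : finType)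
    (e1 : rel T1) (e2 : rel T2) :
  isospectral C (doubling e1) (doubling e2) <-> isospectral C e1 e2.
Proof.
rewrite /isospectral !card_prod; split=> -[/eqP eqT eqS].
  have {}eqT : #|T1| = #|T2| by apply/eqP; move: eqT; rewrite eqn_pmul2r ?card_ord.
  by split=> //; apply/(spectrum_doubling_inj C e1 e2 eqT).
have {}eqT : #|T1| = #|T2| by apply/eqP.
by split; [rewrite eqT | apply/(spectrum_doubling_inj C e1 e2 eqT)].
Qed.

Lemma equienergetic_doubling (C : numClosedFieldType) (T1 T2 : finType)
    (e1 : rel T1) (e2 : rel T2) :
  equienergetic C (doubling e1) (doubling e2) <-> equienergetic C e1 e2.
Proof.
rewrite /equienergetic !card_prod !energy_doubling; split=> -[eqT eqE].
  split; last by apply: mulfI eqE; rewrite pnatr_eq0.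
  by apply/eqP; move/eqP: eqT; rewrite eqn_pmul2r ?card_ord.
by rewrite eqT eqE.
Qed.

Theorem proposition6p1 (R : realType) (gT : finGroupType) (S : {set gT}) :
  (equienergetic R[i] (mixed_cayley_graph S) (mixed_cayley_sum_graph S) /\
   ~ isospectral R[i] (mixed_cayley_graph S) (mixed_cayley_sum_graph S))
  <->
  (equienergetic R[i] (cayley_graph S) (cayley_sum_graph S) /\
   ~ isospectral R[i] (cayley_graph S) (cayley_sum_graph S)).
Proof.
by rewrite /mixed_cayley_graph /mixed_cayley_sum_graph equienergetic_doubling
  isospectral_doubling.
Qed.
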